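(* Let properties (P1)--(P13) listed in the context be fulfilled. Let $\gamma>0$ and, for $k\in\mathbb N$, let $v^k\in X_k$ be a global minimizer of $$\min_{v\in X_k}\; j(v)+\psi_\gamma(v)+\eta(v).$$ Then there exists a subsequence $(v^k)_{k\in K}$, $K\subset\mathbb N$, that converges to some $v_\gamma\in X\cap Y$ with respect to the strong topology in $W$, the weak topology in $X$ and the weak$^\ast$ topology in $Y$, and $v_\gamma$ fulfills $$j(v_\gamma)+\psi_\gamma(v_\gamma)+\eta(v_\gamma)\le j(w)+\psi_\gamma(w)+\eta(w)\quad\text{for all } w\in X\cap Z.$$
   Context: Properties: (P1) $X$ is a Hilbert space, $W$ is a separable Banach space, and the embedding $X\hookrightarrow W$ is compact. (P2) $Y$ is the dual of a separable Banach space (weak$^\ast$ convergence in $Y$ refers to this predual). (P3) The embedding $Y\hookrightarrow W$ is continuous. (P4) For each sequence $(v^k)_{k\in\mathbb N}\subset X\cap Y$ that converges weakly to $\hat v$ in $X$ and weakly$^\ast$ to $\bar v$ in $Y$, it holds that $\hat v=\bar v$ in $X\cap Y$. (P5) For each $\gamma>0$, $\psi_\gamma:Y\to\mathbb R\cup\{\infty\}$ is weakly$^\ast$ sequentially lower semicontinuous. (P6) $\eta:X\to\mathbb R$ is weakly lower semicontinuous. (P7) $j:Y\to\mathbb R$ is continuous w.r.t. the $W$-topology: if $(v^k)_{k\in\mathbb N}\subset Y$, $v\in Y$ and $v^k\to v$ strongly in $W$, then $j(v^k)\to j(v)$. (P8) The functions $j$, $\psi_\gamma$ ($\gamma>0$)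 and $\eta$ are bounded from below on $X\cap Y$. (P9) Boundedness of $(\psi_\gamma(v^k)+\eta(v^k))_{k\in\mathbb N}$ (for a sequence $(v^k)_{k\in\mathbb N}\subset X\cap Y$) implies boundedness of $(\|v^k\|_Y+\|v^k\|_X)_{k\in\mathbb N}$. (P10) $Z$ is a Banach space such that $Z\hookrightarrow Y$ (continuously). (P11) $X_k\subset X\cap Z$ ($k\in\mathbb N$) are subspaces such that $X_k\subset X_{k+1}$ for all $k$, and for all $w\in X\cap Z$ there exists a sequence $(w^k)_{k\in\mathbb N}$ with $w^k\in X_k$ such that $w^k\to w$ strongly in $X$ and $(\|w^k\|_Z)_{k\in\mathbb N}$ is bounded. (P12) For each $\gamma>0$, each bounded sequence $(v^k)_{k\in\mathbb N}\subset Z$ and $v\in Z$ such that $v^k\to v$ strongly in $W$, it follows that $\lim_{k\to\infty}\psi_\gamma(v^k)=\psi_\gamma(v)$. (P13) $\eta:X\to\mathbb R$ is strongly continuous. *)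

(* Defs.v *)
From mathcomp Require Import all_boot all_order all_algebra.
From mathcomp Require Import all_classical all_reals all_analysis.

Set Implicit Arguments.
Unset Strict Implicit.
Unset Printing Implicit Defensive.

Import Order.TTheory GRing.Theory Num.Theory.
Import numFieldNormedType.Exports.

Local Open Scope classical_set_scope.
Local Open Scope ring_scope.

Definition separable (T : topologicalType) : Prop :=
  exists2 D : set T, countable D & dense D.

(* The complete space X is a Hilbert space when its norm comes from an inner
   product; [{dot X for idfun}] is the type of (real) inner products on X. *)
Definition norm_of_dot (R : realType) (X : normedModType R)
    (dot : {dot X for idfun}) : Prop :=
  forall x : X, `|x| ^+ 2 = dot x x.

(* Inclusions of (real) normed spaces are rendered as injective linear maps. *)
Definition continuous_embedding (R : realType) (U V : normedModType R)
    (i : {linear U -> V}) : Prop :=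
  injective i /\ continuous i.

Definition compact_embedding (R : realType) (U V : normedModType R)
    (i : {linear U -> V}) : Prop :=
  continuous_embedding i /\
  forall A : set U, bounded_set A -> precompact (i @` A).

(* The intersection of U and V inside W: an element is given by its
   representatives u in U and v in V, which agree in W. *)
Definition meet_in (U V W : Type) (i : U -> W) (j : V -> W) : set (U * V) :=
  [set v | i v.1 = j v.2].

Definition topdual (R : realType) (V : normedModType R) : Type :=
  {f : {scalar V} | continuous f}.

Definition dual_eval (R : realType) (V : normedModType R) (x : V) :
  {ptws topdual V -> R} := fun f => sval f x.

(* V with the coarsest topology making every continuous linear functional
   continuous. *)
Notation weak V := (initial_topology (@dual_eval _ V)).

Definition weak_cvg (R : realType) (V : normedModType R)
    (u : nat -> V) (l : V) : Prop :=
  (u : nat -> weak V) @ \oo --> (l : weak V).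

Definition weakly_lsc (R : realType) (V : normedModType R)
    (f : V -> \bar R) : Prop :=
  lower_semicontinuous (f : weak V -> \bar R).

(* The pairing d identifies Y, with its norm, with the dual of P: y |-> d y is
   an isometry onto the continuous linear functionals with the operator norm. *)
Definition dual_pairing (R : realType) (P Y : normedModType R)
    (d : {bilinear Y -> P -> R^o}) : Prop :=
  [/\ forall y : Y, continuous (d y : P -> R),
      forall f : topdual P, exists y : Y, forall p : P, d y p = sval f p
    & forall y : Y, `|y| = sup [set `|d y p| | p in [set p : P | `|p| <= 1]]].

Definition pairing_eval (R : realType) (P Y : normedModType R)
  (d : {bilinear Y -> P -> R^o}) (y : Y) : {ptws P -> R} := d y.

Notation weakstar d := (initial_topology (pairing_eval d)).

Definition weakstar_cvg (R : realType) (P Y : normedModType R)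
    (d : {bilinear Y -> P -> R^o}) (u : nat -> Y) (l : Y) : Prop :=
  (u : nat -> weakstar d) @ \oo --> (l : weakstar d).

Definition weakstar_seq_lsc (R : realType) (P Y : normedModType R)
    (d : {bilinear Y -> P -> R^o}) (f : Y -> \bar R) : Prop :=
  forall (u : nat -> Y) (l : Y), weakstar_cvg d u l ->
    (f l <= limn_einf (fun k => f (u k)))%E.

Definition bounded_below_on (R : realType) (T : Type) (A : set T)
    (f : T -> \bar R) : Prop :=
  exists m : R, forall v, A v -> (m%:E <= f v)%E.

(* Usual convention for extended-valued objectives: a global minimizer has a
   finite value, i.e. an objective identically +oo on S has no minimizer. *)
Definition global_minimizer (R : realType) (T : Type) (S : set T)
    (F : T -> \bar R) (v : T) : Prop :=
  [/\ S v, (F v < +oo)%E & forall w, S w -> (F v <= F w)%E].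

Definition objective (R : realType) (X Y : Type) (j : Y -> R)
    (psi : Y -> \bar R) (eta : X -> R) (x : X) (y : Y) : \bar R :=
  ((j y)%:E + psi y + (eta x)%:E)%E.

(* Main.v *)
(* Since v^0 lies in every X_k, the objective values at v^k are bounded above by
   the one at v^0, so v^k is bounded in X and Y.  An ultrafilter on the indices
   makes v^k converge in W (compactness) and weakly-* in Y (Banach-Alaoglu); as
   the predual of Y is separable, a subsequence has the same limits.

   Weak convergence in X then needs no Riesz representation and no further
   subsequence: if v^k -> w in W and frequently f(v^k) >= a, the convex sets
   {|x| <= M, |x - w|_W <= 1/(n+1), f(x) >= a} are nonempty and nested, and their
   points of almost minimal norm converge to a preimage of w where f >= a; as
   the preimage of w is unique, f(v^k) converges to its image under f.

   The inequality passes to the limit by lower semicontinuity at v^k and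
   continuity along the sequence w^k -> w given by (P11). *)
Require Import Defs.
From HB Require Import structures.
From mathcomp Require Import all_boot all_order all_algebra.
From mathcomp Require Import all_classical all_reals all_analysis.
From mathcomp Require Import ring lra.
Import Order.TTheory GRing.Theory Num.Theory.
Import numFieldNormedType.Exports.
Local Open Scope classical_set_scope.
Local Open Scope ring_scope.

Set Implicit Arguments.
Unset Strict Implicit.
Unset Printing Implicit Defensive.

(** * Weak and weak-star convergence, tested functional by functional *)

Lemma cvg_initialP (S : choiceType) (T : topologicalType) (f : S -> T)
    (F : set_system S) (s : S) : Filter F ->
  F --> (s : initial_topology f) <-> f @ F --> f s.
Proof.
move=> FF; split=> [Fs A|Fs A].
  by move=> /(@initial_continuous _ _ f s) /Fs.
by rewrite /= => -[_ [[B Bop <-] Bfs sBA]]; apply: filterS sBA _; apply: Fs;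
  exact: open_nbhs_nbhs.
Qed.

Lemma cvg_initial_ptwsP (R : realType) (S : choiceType) (T : Type)
    (f : S -> {ptws T -> R}) (u : nat -> S) (l : S) :
  (u : nat -> initial_topology f) @ \oo --> (l : initial_topology f) <->
  forall t, (fun k => f (u k) t) @ \oo --> f l t.
Proof.
rewrite cvg_initialP; split=> [fl t|fl].
  by move/cvg_sup/(_ t)/cvg_initialP : fl.
by apply/cvg_sup => t; apply/cvg_initialP; exact: fl.
Qed.

Lemma weak_cvgP (R : realType) (V : normedModType R) (u : nat -> V) (l : V) :
  weak_cvg u l <-> forall f : topdual V, sval f \o u @ \oo --> sval f l.
Proof. exact: cvg_initial_ptwsP. Qed.

Lemma weakstar_cvgP (R : realType) (P Y : normedModType R)
    (d : {bilinear Y -> P -> R^o}) (u : nat -> Y) (l : Y) :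
  weakstar_cvg d u l <-> forall p, (fun k => d (u k) p : R) @ \oo --> (d l p : R).
Proof. exact: cvg_initial_ptwsP. Qed.

(** * Hilbert space geometry and weak convergence through an embedding *)

Lemma norm_of_dot_parallelogram (R : realType) (X : normedModType R)
    (dot : {dot X for idfun}) (x y : X) : norm_of_dot dot ->
  `|x + y| ^+ 2 + `|x - y| ^+ 2 = 2 * `|x| ^+ 2 + 2 * `|y| ^+ 2.
Proof.
move=> dotE; rewrite !dotE !(linearDl, linearDr, linearNl, linearNr) /=; ring.
Qed.

(** Convexity restricted to midpoints, which is what the parallelogram identity calls for. *)
Definition midpoint_closed {R : realType} {X : normedModType R} (A : set X) :=
  forall x y, A x -> A y -> A (2^-1 *: (x + y)).

(* By the parallelogram identity, points of almost minimal norm in a decreasing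
   sequence of convex sets form a Cauchy sequence. *)
Lemma hilbert_nested_midpoint_closed (R : realType)
    (X : completeNormedModType R) (dot : {dot X for idfun}) (M : R)
    (A : nat -> set X) :
  norm_of_dot dot ->
  (forall n, midpoint_closed (A n)) ->
  {homo A : m n / (m <= n)%N >-> n `<=` m} ->
  (forall n, A n !=set0) ->
  (forall x, A 0%N x -> `|x| <= M) ->
  exists2 c : nat -> X, (forall n, A n (c n)) & cvgn c.
Proof.
move=> dotE Amid Anest A0 AM.
pose N n : set R := [set `|x| ^+ 2 | x in A n].
have N0 n : N n !=set0 by have [x Ax] := A0 n; exists (`|x| ^+ 2), x.
have Nlb n : has_lbound (N n) by exists 0 => _ [x _ <-]; exact: sqr_ge0.
pose dist n := inf (N n).
have dist_le n x : A n x -> dist n <= `|x| ^+ 2.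
  by move=> Ax; apply: ge_inf => //; exists x.
have dist_mono : {homo dist : m n / (m <= n)%N >-> m <= n}.
  move=> m n mn; apply: lb_le_inf => // _ [x Ax <-].
  exact/dist_le/(Anest _ _ mn).
have dist_ub : has_ubound (range dist).
  exists (M ^+ 2) => _ [n _ <-]; have [x Ax] := A0 n.
  rewrite (le_trans (dist_le _ _ Ax))// lerXn2r ?nnegrE//; last first.
    exact/AM/(Anest _ _ (leq0n n)).
  exact: le_trans (AM x (Anest _ _ (leq0n n) _ Ax)).
have /choice[c cP] : forall n, exists x, A n x /\ `|x| ^+ 2 < dist n + n.+1%:R^-1.
  move=> n; have n0 : 0 < n.+1%:R^-1 :> R by rewrite invr_gt0.
  have [_ [x Ax <-] xlt] := inf_adherent n0 (conj (N0 n) (Nlb n)).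
  by exists x.
exists c; first by move=> n; have [] := cP n.
apply/cauchy_cvgP/cauchy_ballP => e e0.
(* By the parallelogram identity [|c m - c n| ^+ 2] is below twice [dist n - dist m] plus twice the
   two slacks. That difference is below [2 * delta] and each slack below [delta]: [8 * delta] in
   all. *)
pose delta := e ^+ 2 / 8.
have delta0 : 0 < delta by rewrite divr_gt0// exprn_gt0.
have /cvgrPdist_lt/(_ _ delta0)[n1 _ n1P] := nondecreasing_is_cvgn dist_mono dist_ub.
have [n2 _ n2P] := near_infty_natSinv_lt (PosNum delta0).
have key m n : (maxn n1 n2 <= m <= n)%N -> `|c m - c n| < e.
  move=> /andP[]; rewrite geq_max => /andP[n1m n2m] mn.
  have := n1P _ n1m; have := n1P _ (leq_trans n1m mn).
  have /= := n2P _ n2m; have /= := n2P _ (leq_trans n2m mn).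
  have [[Am cm] [An cn]] := (cP m, cP n).
  have := dist_le _ _ (Amid m _ _ Am (Anest _ _ mn _ An)).
  rewrite normrZ exprMn ger0_norm ?invr_ge0//.
  have := norm_of_dot_parallelogram (c m) (c n) dotE.
  rewrite !ltr_norml => par mid hn hm /andP[h1 h2] /andP[h3 h4].
  rewrite -(@ltr_pXn2r _ 2) ?nnegrE ?(ltW e0)//.
  have -> : e ^+ 2 = 8 * delta by rewrite /delta mulrCA divff ?mulr1.
  have mid4 : 4 * dist m <= `|c m + c n| ^+ 2.
    by rewrite -ler_pdivlMl//; move: mid; rewrite exprVn -natrX.
  move: (limn dist) (dist m) (dist n) (delta) (`|c m + c n| ^+ 2)
    (`|c m| ^+ 2) (`|c n| ^+ 2) (`|c m - c n| ^+ 2) (m.+1%:R^-1) (n.+1%:R^-1)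
    par mid4 hn hm h1 h2 h3 h4 cm cn => *; lra.
pose tail := c @` [set n | (maxn n1 n2 <= n)%N].
exists (tail, tail).
  by split; exists (maxn n1 n2) => // n; exists n.
move=> [_ _] /= [[m mN <-] [n nN <-]]; rewrite -ball_normE /=.
have [mn|/ltnW nm] := leqP m n; first by apply: key; rewrite mN.
by rewrite distrC; apply: key; rewrite nN.
Qed.

(** Stated for preimages of balls, to cover both norm balls of [X] (identity map, centre 0) and
    balls around the limit in [W]. *)
Lemma midpoint_closed_ball (R : realType) (X W : normedModType R)
    (f : {linear X -> W}) (w : W) (r : R) :
  midpoint_closed [set x | `|f x - w| <= r].
Proof.
move=> x y /= xr yr.
have -> : f (2^-1 *: (x + y)) - w = 2^-1 *: ((f x - w) + (f y - w)).
  have {1}-> : w = 2^-1 *: (w + w).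
    by rewrite -mulr2n -(scaler_nat 2 w) scalerA mulVf ?scale1r ?pnatr_eq0.
  by rewrite linearZ/= linearD -scalerBr opprD addrACA.
rewrite normrZ ger0_norm ?invr_ge0// ler_pdivrMl// mulr_natl mulr2n.
by rewrite (le_trans (ler_normD _ _))// lerD.
Qed.

(** Plays the role of Mazur's theorem: the sets [A n] are cut out of [C] and have images within
    [n.+1%:R^-1] of [w], so the limit of [c] lies in [C] and maps to [w]. *)
Lemma hilbert_mem_limit (R : realType) (X : completeNormedModType R)
    (W : normedModType R) (dot : {dot X for idfun}) (i : {linear X -> W})
    (C : set X) (u : nat -> X) (w : W) (M : R) :
  norm_of_dot dot -> continuous i ->
  closed C -> midpoint_closed C ->
  (forall k, `|u k| <= M) -> i \o u @ \oo --> w ->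
  (forall N, exists2 k, (N <= k)%N & C (u k)) ->
  exists2 x, C x & i x = w.
Proof.
move=> dotE icont Ccl Cmid uM iuw uC.
pose A n := C `&` [set x | `|x| <= M] `&` [set x | `|i x - w| <= n.+1%:R^-1].
have [|||| c Ac cc] := @hilbert_nested_midpoint_closed R X dot M A dotE.
- move=> n x y [[Cx Mx] ix] [[Cy My] iy]; split; last exact: midpoint_closed_ball.
  split; first exact: Cmid.
  have := @midpoint_closed_ball R X X idfun 0 M x y.
  by rewrite /= !subr0; apply.
- move=> m n mn x [Cx]; split=> //=; apply: le_trans b _.
  by rewrite lef_pV2 ?posrE// ler_nat.
- move=> n.
  have n0 : 0 < n.+1%:R^-1 :> R by rewrite invr_gt0.
  have /cvgrPdist_le/(_ _ n0)[N _ NP] := iuw.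
  have [k Nk Cuk] := uC N; exists (u k); split; first by split=> //=.
  by rewrite /= distrC; exact: NP.
- by move=> x [[]].
exists (limn c).
  by apply: closed_cvg cc => //; apply: nearW => n; have [[]] := Ac n.
have ic : i (c n) @[n --> \oo] --> i (limn c) by exact: continuous_cvg (icont _) cc.
apply: cvg_unique ic _ => //=.
apply/cvgrPdist_lt => e e0; have [N _ NP] := near_infty_natSinv_lt (PosNum e0).
exists N => // n /NP /=; apply: le_lt_trans.
by rewrite distrC; have [] := Ac n.
Qed.

Lemma compact_embedding_weak_cvg (R : realType) (X : completeNormedModType R)
    (W : normedModType R) (dot : {dot X for idfun}) (i : {linear X -> W})
    (u : nat -> X) (w : W) (M : R) :
  norm_of_dot dot -> continuous_embedding i ->
  (forall k, `|u k| <= M) -> i \o u @ \oo --> w ->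
  exists2 x, i x = w & weak_cvg u x.
Proof.
move=> dotE [iinj icont] uM iuw.
have lim C (Ccl : closed C) (Cmid : midpoint_closed C) :=
  hilbert_mem_limit dotE icont Ccl Cmid uM iuw.
have [x _ ix] : exists2 x, [set: X] x & i x = w.
  by apply: (lim _ closedT) => // N; exists N.
exists x => //; apply/weak_cvgP => -[f fcont] /=.
(* Taking [s] to be 1 and -1 yields both bounds on [f]. If [u] kept returning to the half-space
   where [a <= s * f], that half-space would contain a preimage of [w], hence [x] by injectivity. *)
have key (s : R) : forall a, s * f x < a -> \forall k \near \oo, s * f (u k) < a.
  move=> a fxa; apply: contrapT => nu.
  have [y /= ay iy] : exists2 y, a <= s * f y & i y = w.
    apply: (lim [set y | a <= s * f y]).
    - apply: (@closed_comp _ _ (fun y => s * f y) [set z | a <= z]).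
        by move=> y _; apply: cvgM; [exact: cvg_cst|exact: fcont].
      exact: closed_ge.
    - move=> y z /= ay az.
      by rewrite linearZ/= linearD mulrCA mulrDr ler_pdivlMl// mulr_natl mulr2n lerD.
    - move=> N; apply: contrapT => h; apply: nu; exists N => // k /= Nk.
      by rewrite ltNge; apply/negP => ask; apply: h; exists k.
  have yx : y = x by apply: iinj; rewrite ix iy.
  by move: ay; rewrite yx leNgt fxa.
apply/cvgrPdist_lt => e e0.
have h1 : 1 * f x < f x + e by rewrite mul1r ltrDl.
have h2 : -1 * f x < - f x + e by rewrite mulN1r ltrDl.
near=> k; rewrite distrC /=.
have : 1 * f (u k) < f x + e by near: k; exact: key.
have : -1 * f (u k) < - f x + e by near: k; exact: key.
rewrite mul1r mulN1r ltrNl opprD opprK => lo hi.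
by rewrite ltr_norml ltrBrDr ltrBlDr [- e + _]addrC [e + _]addrC lo hi.
Unshelve. all: by end_near. Qed.

(** * Ultrafilter limits, Banach-Alaoglu and extraction of subsequences *)

Lemma ultra_compact_cvg (T : Type) (V : topologicalType) (F : set_system T)
    (s : T -> V) (K : set V) : UltraFilter F ->
  compact K -> (forall t, K (s t)) -> exists2 p, K p & s @ F --> p.
Proof.
move=> FU Kc Ks.
have [p [Kp clp]] := Kc (s @ F) _ (filterE _ Ks); exists p => // B Bp.
(* An ultrafilter contains the preimage of [B] or that of its complement; in the second case the
   cluster point [p] would make [B] meet its complement. *)
have [//|FsB] := in_ultra_setVsetC (s @^-1` B) FU.
by have [z []] := clp (~` B) B FsB Bp.
Qed.

(** Diagonal extraction: members of a proper filter finer than [\oo] meet every tail, so [E n] has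
    elements beyond the index chosen before. *)
Lemma filter_increasing_seq (F : set_system nat) (E : nat -> set nat) :
  ProperFilter F -> \oo `<=` F -> (forall n, F (E n)) ->
  exists2 phi : nat -> nat, {homo phi : m n / (m < n)%N} &
    forall n, E n (phi n).
Proof.
move=> FF ooF FE.
have ex n N : exists k, (N <= k)%N /\ E n k.
  have : F ([set k | (N <= k)%N] `&` E n).
    by apply: filterI => //; apply: ooF; exists N.
  by move=> /filter_ex[k [Nk Ek]]; exists k.
have /choice[g gP] : forall q, exists k, (q.2 <= k)%N /\ E q.1 k.
  by move=> -[n N]; exact: ex.
pose phi := fix phi n := if n is n'.+1 then g (n, (phi n').+1) else g (0%N, 0%N).
exists phi; last by case=> [|n]; [exact: (gP (_, _)).2|exact: (gP (n.+1, (phi n).+1)).2].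
by apply: homo_ltn => [|n]; [exact: ltn_trans|exact: (gP (n.+1, (phi n).+1)).1].
Qed.

Lemma dual_pairing_le (R : realType) (P Y : normedModType R)
    (d : {bilinear Y -> P -> R^o}) (y : Y) (p : P) :
  dual_pairing d -> `|d y p| <= `|y| * `|p|.
Proof.
move=> [dcont _ dnorm].
(* Continuity bounds the values on the unit ball, so that [sup] is a true supremum and not the
   default value for unbounded sets. *)
have [r r0 rP] : exists2 r, 0 < r & forall p, `|d y p| <= r * `|p|.
  by apply/pinfty_ex_gt0/linear_boundedP/linear_bounded_continuous/dcont.
have [->|p0] := eqVneq p 0; first by rewrite linear0r !normr0 mulr0.
have np0 : 0 < `|p| by rewrite normr_gt0.
rewrite -ler_pdivrMr// dnorm; apply: sup_upper_bound.
  split; first by exists `|d y 0|, 0 => //=; rewrite normr0.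
  exists r => _ [q /= q1 <-]; rewrite (le_trans (rP q))//.
  by rewrite ler_piMr// ltW.
exists (`|p|^-1 *: p) => /=.
  by rewrite normrZ normfV normr_id mulVf// gt_eqF.
by rewrite linearZr_LR normrZ normfV normr_id mulrC.
Qed.

(** Each [d (y t) p] stays in a compact interval, hence converges along the ultrafilter; the limits
    form a bounded linear functional, which the pairing represents by some [l]. *)
Lemma banach_alaoglu (R : realType) (P Y : normedModType R)
    (d : {bilinear Y -> P -> R^o}) (T : Type) (F : set_system T)
    (y : T -> Y) (M : R) :
  dual_pairing d -> UltraFilter F -> (forall t, `|y t| <= M) ->
  exists l, forall p, (d (y t) p : R) @[t --> F] --> (d l p : R).
Proof.
move=> dd FU yM; have [_ dsurj _] := dd.
have dM t p : `|d (y t) p| <= M * `|p|.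
  by rewrite (le_trans (dual_pairing_le _ _ dd))// ler_wpM2r.
have /choice[L LP] : forall p, exists l : R, (d (y t) p : R) @[t --> F] --> l.
  move=> p; have [t|l _ ?] := @ultra_compact_cvg _ _ F (fun t => d (y t) p : R)
    _ FU (@segment_compact _ (- (M * `|p|)) (M * `|p|)); last by exists l.
  by rewrite /= in_itv/= -ler_norml.
have Llin : linear_for *%R L.
  move=> a p q.
  have h : (d (y t) (a *: p + q) : R) @[t --> F] --> a * L p + L q.
    rewrite (_ : (fun t => _) = fun t => a * d (y t) p + d (y t) q); last first.
      by apply/funext => t; rewrite linearPr.
    by apply: cvgD => //; apply: cvgM => //; exact: cvg_cst.
  exact: cvg_unique (LP _) h.
have LM p : `|L p| <= M * `|p|.
  apply: (@closed_cvg _ _ F _ (fun t => `|d (y t) p| : R) [set z | z <= M * `|p|]).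
  - exact: closed_le.
  - by apply: nearW => t; exact: dM.
  - exact: cvg_norm (LP p).
pose L' : {scalar P} := HB.pack L (GRing.isLinear.Build R P R *%R L Llin).
have L'cont : continuous L'.
  move=> p; apply/cvgrPdist_lt => e e0.
  near=> q; rewrite -linearB (le_lt_trans (LM _))//.
  rewrite (@le_lt_trans _ _ ((`|M| + 1) * `|p - q|))//.
    by rewrite ler_wpM2r// (le_trans (ler_norm M))// lerDl.
  rewrite -ltr_pdivlMl ?ltr_wpDl//.
  by near: q; apply: cvgr_dist_lt => //; rewrite mulr_gt0// invr_gt0 ltr_wpDl.
have [l lP] := dsurj (exist _ L' L'cont).
by exists l => p; rewrite lP /=; exact: LP.
Unshelve. all: by end_near. Qed.

(** An e/3 argument: the bound [M] makes all these functionals equally Lipschitz, so testing on a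
    dense set is enough. *)
Lemma weakstar_cvg_dense (R : realType) (P Y : normedModType R)
    (d : {bilinear Y -> P -> R^o}) (D : set P) (u : nat -> Y) (l : Y) (M : R) :
  dual_pairing d -> dense D -> (forall k, `|u k| <= M) -> `|l| <= M ->
  (forall p, D p -> (d (u k) p : R) @[k --> \oo] --> (d l p : R)) ->
  weakstar_cvg d u l.
Proof.
move=> dd Ddense uM lM uD; apply/weakstar_cvgP => p.
apply/cvgrPdist_lt => e e0.
have M0 : 0 <= M by apply: le_trans lM.
have M1 : 0 < M + 1 by rewrite ltr_wpDl.
have r0 : 0 < e / 3 / (M + 1) by rewrite !divr_gt0.
have [|q [pq Dq]] := Ddense (ball p (e / 3 / (M + 1))) _ (ball_open p _).
  by exists p; exact: ballxx.
move: pq; rewrite -ball_normE /= => pq.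
have small v : `|v| <= M -> `|d v (p - q)| < e / 3.
  move=> vM; rewrite (le_lt_trans (dual_pairing_le _ _ dd))//.
  rewrite (@le_lt_trans _ _ ((M + 1) * `|p - q|))//.
    by rewrite ler_wpM2r// (le_trans vM)// lerDl.
  by rewrite -ltr_pdivlMl// mulrC.
have e3 : 0 < e / 3 by rewrite divr_gt0.
have /cvgrPdist_lt/(_ _ e3) := uD _ Dq.
apply: filterS => k /= qk.
have := small _ (uM k); have := small _ lM; rewrite !linearBr.
move: qk.
move: (d l p : R) (d l q : R) (d (u k) p : R) (d (u k) q : R) => a b a' b'.
rewrite !ltr_norml => /andP[? ?] /andP[? ?] /andP[? ?].
by apply/andP; split; lra.
Qed.

Lemma increasing_cvg_infty (phi : nat -> nat) :
  {homo phi : m n / (m < n)%N} -> phi @ \oo --> \oo.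
Proof.
move=> phi_incr A [N _ NA]; exists N => // n /= Nn; apply: NA => /=.
apply: leq_trans Nn _; elim: n => // n ih.
exact: leq_ltn_trans ih (phi_incr _ _ (ltnSn n)).
Qed.

(** One ultrafilter supplies both limits; separability reduces closeness to them to countably many
    conditions, which a subsequence can meet in turn. *)
Lemma compact_weakstar_cvg_subseq (R : realType) (W P Y : normedModType R)
    (d : {bilinear Y -> P -> R^o}) (K : set W) (z : nat -> W) (y : nat -> Y)
    (M : R) :
  separable P -> dual_pairing d -> compact K ->
  (forall k, K (z k)) -> (forall k, `|y k| <= M) ->
  exists (phi : nat -> nat) (w : W) (l : Y),
    [/\ {homo phi : m n / (m < n)%N}, z \o phi @ \oo --> w &
        weakstar_cvg d (y \o phi) l].
Proof.
move=> [D /countable_injP[f finj] Ddense] dd Kc zK yM.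
have [F [FU ooF]] := ultraFilterLemma eventually_filter.
have [w _ Fw] := ultra_compact_cvg FU Kc zK.
have [l Fl] := banach_alaoglu dd FU yM.
(* [f] numbers the points of [D]. Only those numbered up to [n] are tested in [E n]: finitely many
   conditions, so [E n] belongs to the ultrafilter. *)
pose E n : set nat := [set k | `|w - z k| < n.+1%:R^-1 /\
  forall (m : 'I_n.+1) p, D p -> f p = m -> `|d l p - d (y k) p| < n.+1%:R^-1].
have [n|phi phi_incr Ephi] := @filter_increasing_seq F E _ ooF.
  have n0 : 0 < n.+1%:R^-1 :> R by rewrite invr_gt0.
  apply: filterI; first by move/cvgrPdist_lt : Fw; exact.
  apply: filter_forall => m.
  have [[p [Dp fp]]|nop] := pselect (exists p, D p /\ f p = m); last first.
    by apply: nearW => k p Dp fp; exfalso; apply: nop; exists p.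
  move/cvgrPdist_lt : (Fl p) => /(_ _ n0); apply: filterS => k pk q Dq fq.
  by rewrite (finj q p) ?inE// fq fp.
exists phi, w, l; split=> //.
  apply/cvgrPdist_lt => e e0.
  have := near_infty_natSinv_lt (PosNum e0); apply: filterS => n /=.
  by apply: lt_trans; have [] := Ephi n.
(* The limit [l] comes without a norm estimate, so the common bound includes [|l|]. *)
apply: (@weakstar_cvg_dense _ _ _ _ D _ _ (Num.max M `|l|)) => //.
- by move=> k; rewrite le_max yM.
- by rewrite le_max lexx orbT.
move=> p Dp; apply/cvgrPdist_lt => e e0; near=> n.
have [_ /(_ (inord (f p)) p Dp)] := Ephi n.
(* From [n >= f p] on, [p] is among the points tested in [E n], and [inord] does not fall back on
   its default. *)
have fn : (f p < n.+1)%N by rewrite ltnS; near: n; exact: nbhs_infty_ge.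
rewrite inordK// => /(_ erefl) /lt_trans; apply.
by near: n; exact: near_infty_natSinv_lt (PosNum e0).
Unshelve. all: by end_near. Qed.

Lemma limn_einf_le (R : realType) (u : nat -> \bar R) (c : \bar R) :
  (\forall k \near \oo, (u k <= c)%E) -> (limn_einf u <= c)%E.
Proof.
move=> uc; rewrite limn_einf_lim; apply: lime_le; first exact: is_cvg_einfs.
apply: filterS uc => k; apply: le_trans.
by apply: ereal_inf_lbound; exists k => /=.
Qed.

(** * Convergence of the discrete minimizers and optimality of the limit *)

Theorem lemma2p6 (R : realType)
  (X W P Z : completeNormedModType R) (Y : normedModType R)
  (dot : {dot X for idfun}) (d : {bilinear Y -> P -> R^o})
  (iX : {linear X -> W}) (iY : {linear Y -> W}) (iZ : {linear Z -> Y})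
  (psi : R -> Y -> \bar R) (eta : X -> R) (j : Y -> R)
  (Xk : nat -> set (X * Z))
  (XY := meet_in iX iY) (XZ := meet_in iX (iY \o iZ))
  (P1_hilbert : norm_of_dot dot)
  (P1_separable : separable W)
  (P1_compact : compact_embedding iX)
  (P2_separable : separable P)
  (P2_dual : dual_pairing d)
  (P3 : continuous_embedding iY)
  (P4 : forall (v : nat -> X * Y) (vhat : X) (vbar : Y),
    (forall k, XY (v k)) ->
    weak_cvg (fun k => (v k).1) vhat ->
    weakstar_cvg d (fun k => (v k).2) vbar ->
    iX vhat = iY vbar)
  (P5_range : forall g : R, 0 < g -> forall y : Y, psi g y <> -oo%E)
  (P5 : forall g : R, 0 < g -> weakstar_seq_lsc d (psi g))
  (P6 : weakly_lsc (fun x => (eta x)%:E))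
  (P7 : forall (v : nat -> Y) (v0 : Y),
    (fun k => iY (v k)) @ \oo --> iY v0 ->
    (fun k => j (v k)) @ \oo --> j v0)
  (P8_j : bounded_below_on XY (fun v => (j v.2)%:E))
  (P8_psi : forall g : R, 0 < g -> bounded_below_on XY (fun v => psi g v.2))
  (P8_eta : bounded_below_on XY (fun v => (eta v.1)%:E))
  (P9 : forall g : R, 0 < g -> forall v : nat -> X * Y,
    (forall k, XY (v k)) ->
    (exists M : R, forall k,
      (`|psi g (v k).2 + (eta (v k).1)%:E| <= M%:E)%E) ->
    exists M : R, forall k, `|(v k).2| + `|(v k).1| <= M)
  (P10 : continuous_embedding iZ)
  (P11_sub : forall k, Xk k `<=` XZ)
  (P11_subspace : forall k, submod_closed (fun w : X * Z => w \in Xk k))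
  (P11_nested : forall k, Xk k `<=` Xk k.+1)
  (P11_approx : forall w : X * Z, XZ w ->
    exists wk : nat -> X * Z,
      [/\ forall k, Xk k (wk k),
          (fun k => (wk k).1) @ \oo --> w.1
        & exists M : R, forall k, `|(wk k).2| <= M])
  (P12 : forall g : R, 0 < g -> forall (v : nat -> Z) (v0 : Z),
    (exists M : R, forall k, `|v k| <= M) ->
    (fun k => iY (iZ (v k))) @ \oo --> iY (iZ v0) ->
    (fun k => psi g (iZ (v k))) @ \oo --> psi g (iZ v0))
  (P13 : continuous eta)
  (gamma : R) (gamma_gt0 : 0 < gamma)
  (v : nat -> X * Z)
  (v_min : forall k, global_minimizer (Xk k)
    (fun w => objective j (psi gamma) eta w.1 (iZ w.2)) (v k)) :
  exists (phi : nat -> nat) (vg : X * Y),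
    [/\ {homo phi : m n / (m < n)%N},
        XY vg,
        (fun k => iX (v (phi k)).1) @ \oo --> iX vg.1,
        weak_cvg (fun k => (v (phi k)).1) vg.1
      & weakstar_cvg d (fun k => iZ (v (phi k)).2) vg.2] /\
    forall w : X * Z, XZ w ->
      (objective j (psi gamma) eta vg.1 vg.2 <=
       objective j (psi gamma) eta w.1 (iZ w.2))%E.
Proof.
have vX k : Xk k (v k) by have [] := v_min k.
have v_XZ k : XZ (v k) by exact: P11_sub (vX k).
pose vY k : X * Y := ((v k).1, iZ (v k).2).
have vY_XY k : XY (vY k) by exact: v_XZ.
have [[mj mjP] [mp mpP] [me meP]] := And3 P8_j (P8_psi _ gamma_gt0) P8_eta.
have Xk_mono : {homo Xk : m n / (m <= n)%N >-> m `<=` n}.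
  by apply: homo_leq P11_nested => [A|B A C AB BC] x //; move=> /AB /BC.
have psi_bounded : exists M : R, forall k,
    (`|psi gamma (vY k).2 + (eta (vY k).1)%:E| <= M%:E)%E.
  have [_ F0_lty _] := v_min 0%N.
  (* The sum is at most the objective at [v 0] minus [mj], by minimality, and at least [mp + me].
     The objective at [v 0] is finite: [v_min] excludes [+oo] and [P5_range] excludes [-oo]. *)
  exists (`|fine (objective j (psi gamma) eta (v 0%N).1 (iZ (v 0%N).2)) - mj|
          + `|mp + me|) => k.
  have [_ _ /(_ _ (Xk_mono _ _ (leq0n k) _ (vX 0%N)))] := v_min k.
  have := P5_range _ gamma_gt0 (iZ (v 0%N).2).
  have := mpP _ (vY_XY k); have := meP _ (vY_XY k); have := mjP _ (vY_XY k).
  move: F0_lty; rewrite /objective /vY /=.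
  case: (psi gamma (iZ (v 0%N).2)) => [r0| |]//.
  case: (psi gamma (iZ (v k).2)) => [r| |]//=.
  rewrite !lee_fin => _ hj he hp _ hF; rewrite ler_norml.
  set a := (j _ + r0 + _ - mj); have /= := (ler_norm a, ler_norm (- (mp + me))).
  have := (normr_ge0 a, normr_ge0 (mp + me)).
  rewrite normrN => -[ha0 hm0] [ha hm].
  by apply/andP; split; rewrite /a in ha ha0 *; lra.
have [M MP] := P9 _ gamma_gt0 vY vY_XY psi_bounded.
have xM k : `|(v k).1| <= M by rewrite (le_trans _ (MP k))// lerDr.
have yM k : `|iZ (v k).2| <= M by rewrite (le_trans _ (MP k))// lerDl.
have [iX_emb iX_compact] := P1_compact.
have [K ballK [Kcompact _]] : precompact (iX @` [set x | `|x| <= M]).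
  apply: iX_compact; exists M; split=> [|B MB x /= xB]; first exact: num_real.
  exact: le_trans xB (ltW MB).
have [phi [w [yb [phi_incr xw ybP]]]] := compact_weakstar_cvg_subseq
  P2_separable P2_dual Kcompact
  (fun k => ballK _ (imageP iX (xM k : [set x | `|x| <= M] (v k).1))) yM.
have [xb xbw xbP] := compact_embedding_weak_cvg P1_hilbert iX_emb
  (fun k => xM (phi k)) xw.
(* The limits in [X] and [Y] arose separately; [P4] identifies them in [W]. *)
have xyb : XY (xb, yb).
  by apply: (P4 (vY \o phi)) => // k; exact: vY_XY.
have phi_oo := increasing_cvg_infty phi_incr.
exists phi, (xb, yb); split; first by split=> //=; rewrite xbw.
move=> u uXZ.
have [uk [ukX uk_cvg uk_bounded]] := P11_approx u uXZ.
have uk_XZ k : XZ (uk k) by exact: P11_sub (ukX k).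
have ukW : (fun k => iY (iZ (uk k).2)) @ \oo --> iY (iZ u.2).
  have <- : iX u.1 = iY (iZ u.2) by exact: uXZ.
  under eq_fun do rewrite -[iY _]uk_XZ.
  by apply: continuous_cvg uk_cvg; apply: iX_emb.2.
have jv : (fun k => j (iZ (v (phi k)).2)) @ \oo --> j yb.
  apply: P7; have <- : iX xb = iY yb by exact: xyb.
  by under eq_fun do rewrite -[iY _]v_XZ; rewrite xbw.
have ju : (fun k => j (iZ (uk k).2)) @ \oo --> j (iZ u.2) by exact: P7.
have psiu := P12 _ gamma_gt0 _ _ uk_bounded ukW.
have etau : (fun k => eta (uk k).1) @ \oo --> eta u.1.
  by apply: continuous_cvg uk_cvg; exact: P13.
(* A competitor with [psi gamma] equal to [+oo] is trivial and [-oo] is excluded, which leaves a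
   real value [r]. *)
have := P5_range _ gamma_gt0 (iZ u.2); move: psiu; rewrite {2}/objective /=.
case: (psi gamma (iZ u.2)) => [r psiu _| |]//; last by rewrite addey// leey.
apply/lee_addgt0Pr => e e0.
(* Five errors have to fit into [e]: [j] at both limits, [eta] at both, and [psi gamma] along
   [uk]. *)
have e5 : 0 < e / 5 by rewrite divr_gt0.
have near_le (s : nat -> R) (l : R) : s @ \oo --> l ->
    \forall k \near \oo, `|l - s k| < e / 5.
  by move/cvgrPdist_lt; exact.
have eta_lower : \forall k \near \oo, eta xb - e / 5 < eta (v (phi k)).1.
  have [|V /xbP nV VP] := P6 xb (eta xb - e / 5).
    by rewrite lte_fin ltrBlDr ltrDl.
  have etaV k : V (v (phi k)).1 -> eta xb - e / 5 < eta (v (phi k)).1.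
    by move=> /VP; rewrite lte_fin.
  exact: filterS etaV nV.
have [psi_fin psi_cvg] := (fine_cvgP _ _).1 psiu.
have le_psi : (psi gamma yb <=
    (j (iZ u.2) + r + eta u.1 - j yb - eta xb + e)%:E)%E.
  (* Minimality of [v (phi k)] against [uk (phi k)], which lies in the same [Xk (phi k)], is solved
     for [psi gamma] at [v (phi k)]; at the cost of [e] the bound is independent of [k] and passes
     to the lower limit. *)
  apply: le_trans (P5 _ gamma_gt0 _ _ ybP) _; apply: limn_einf_le.
  near=> k.
  have : `|j (iZ u.2) - j (iZ (uk (phi k)).2)| < e / 5.
    by near: k; exact: phi_oo (near_le _ _ ju).
  have : `|eta u.1 - eta (uk (phi k)).1| < e / 5.
    by near: k; exact: phi_oo (near_le _ _ etau).
  have : `|r - fine (psi gamma (iZ (uk (phi k)).2))| < e / 5.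
    by near: k; exact: phi_oo (near_le _ _ psi_cvg).
  have : psi gamma (iZ (uk (phi k)).2) \is a fin_num.
    by near: k; exact: phi_oo psi_fin.
  have : `|j yb - j (iZ (v (phi k)).2)| < e / 5.
    by near: k; exact: near_le jv.
  have : eta xb - e / 5 < eta (v (phi k)).1 by near: k.
  have [_ _ /(_ _ (ukX (phi k)))] := v_min (phi k).
  rewrite /objective /=.
  case: (psi gamma (iZ (uk (phi k)).2)) => [r'| |]//.
  case: (psi gamma (iZ (v (phi k)).2)) => [s| |]//=; last by move=> *; exact: leNye.
  rewrite -!EFinD !lee_fin !ltr_norml => ? ? /andP[? ?] _.
  by move=> /andP[? ?] /andP[? ?] /andP[? ?]; lra.
(* [le_psi] excludes [+oo] at [yb], so only an inequality between reals remains. *)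
have := P5_range _ gamma_gt0 yb; move: le_psi; rewrite /objective /=.
case: (psi gamma yb) => [s| |]//; rewrite -!EFinD !lee_fin => ? _; lra.
Unshelve. all: by end_near. Qed.
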